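(* Let $X$ be a complex Banach space and let $T$ be a uniformly rigid (bounded linear) operator on $X$. Then $T^{-1}$ is also uniformly rigid.
   Context: A bounded linear operator $T$ on a Banach space $X$ is called uniformly rigid if there is a strictly increasing sequence of positive integers $(k_n)_{n\in\mathbb{N}}$ (so $k_n\to\infty$) such that $\|T^{k_n}-I\|=\sup_{\|x\|\le 1}\|T^{k_n}x-x\|\to 0$ as $n\to\infty$. A uniformly rigid operator is invertible (has a bounded inverse), so $T^{-1}$ makes sense. *)

(* Defs.v *)
From HB Require Import structures.
From mathcomp Require Import all_boot all_order all_algebra.
From mathcomp Require Import all_classical all_reals all_analysis.
From mathcomp Require Export complex.

Set Implicit Arguments.
Unset Strict Implicit.
Unset Printing Implicit Defensive.

Import Order.TTheory GRing.Theory Num.Theory.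
Import numFieldNormedType.Exports.

Local Open Scope classical_set_scope.
Local Open Scope ring_scope.
Local Open Scope complex_scope.

(* On a normedModType over R[i], the norm takes its values in R[i]; they are
   nonnegative, hence of the form r%:C, and complex.Re recovers r : R. *)

Definition bounded_operator (R : realType) (X : normedModType R[i])
    (T : {linear X -> X}) : Prop :=
  exists M : R, forall x : X, `|T x| <= M%:C * `|x|.

(* Extended-real valued, so that the supremum over the closed unit ball is
   genuine (+oo for an unbounded f) rather than a default value. *)
Definition opnorm (R : realType) (X : normedModType R[i]) (f : X -> X)
    : \bar R :=
  ereal_sup [set (complex.Re `|f x|)%:E | x in [set x : X | `|x| <= 1]].

(* increasing_seq is strict monotonicity: k m <= k n iff m <= n. *)
Definition uniformly_rigid (R : realType) (X : normedModType R[i])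
    (T : {linear X -> X}) : Prop :=
  bounded_operator T /\
  exists k : nat -> nat,
    [/\ increasing_seq k,
        forall n, (0 < k n)%N
      & opnorm (fun x => iter (k n) T x - x) @[n --> \oo] --> 0%E].

(* Main.v *)
Require Import Defs.
From HB Require Import structures.
From mathcomp Require Import all_boot all_order all_algebra.
From mathcomp Require Import all_classical all_reals all_analysis.

Import Order.TTheory GRing.Theory Num.Theory.
Import numFieldNormedType.Exports.

Set Implicit Arguments.
Unset Strict Implicit.
Unset Printing Implicit Defensive.

Local Open Scope ring_scope.
Local Open Scope complex_scope.

(** Rigidity says that the powers [T^k_n] converge to the identity in norm, so
    [T^(k_n - 1)] should converge to [T^-1]; the proof obtains the inverse
    as this limit.

    Fix [N = k_n] with [|T^N x - x| <= |x| / 2] for all [x]. Then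
    [|x| <= 2 |T^N x| <= 2 |T^(N-1)| |T x|]: [T] is bounded below
    ([rigid_bounded_below]), hence injective. It is also onto: given [y], put
    [u_n = T^(k_n - 1) y]. The sequence [T u_n = T^k_n y] converges to [y], so
    it is Cauchy; as [T] is bounded below, [u_n] is Cauchy too, and by completeness
    and continuity its limit is sent by [T] to [y] ([rigid_surjective]). The
    lower bound for [T] is precisely the boundedness of the inverse [S].

    Finally [S] is rigid along the same exponents ([rigid_inverse]). With
    [z = S^k x], so that [x = T^k z], one has [S^k x - x = - (T^k z - z)], and
    [|z| <= 2 |x|] as soon as [T^k] is within 1/2 of the identity.

    All estimates are done with pointwise bounds [|f x| <= e |x|], to which
    [cvg_opnorm0P] reduces convergence of operator norms to 0; the constants are
    positive elements of [R[i]], where the norm takes its values. *)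

Lemma norm_RRe (R : realType) (X : normedModType R[i]) (x : X) :
  (complex.Re `|x|)%:C = `|x|.
Proof. exact: RRe_real (normr_real x). Qed.

Lemma scalable0 (R : realType) (X : normedModType R[i]) (f : X -> X) :
  scalable f -> f 0 = 0.
Proof. by move=> fZ; have := fZ 0 0; rewrite !scale0r. Qed.

(** Rescaling [x] to the unit vector [|x|^-1 *: x] transfers a bound on the unit
    ball to all vectors. *)
Lemma opnorm_leP (R : realType) (X : normedModType R[i]) (f : X -> X) (e : R) :
  scalable f -> 0 <= e ->
  (opnorm f <= e%:E)%E <-> (forall x, `|f x| <= e%:C * `|x|).
Proof.
move=> fZ e0; split=> [fe x|fe].
  have [->|x0] := eqVneq x 0.
    by rewrite scalable0 // !normr0 mulr0.
  have nx0 : `|x| != 0 by rewrite normr_eq0.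
  have xE : x = `|x| *: (`|x|^-1 *: x) by rewrite scalerA divff // scale1r.
  rewrite [in leLHS]xE fZ normrZ normr_id mulrC ler_wpM2r //.
  rewrite -[leLHS]norm_RRe lecR -lee_fin; apply: le_trans fe.
  apply: ereal_sup_ubound; exists (`|x|^-1 *: x) => //=.
  by rewrite normrZ normfV normr_id mulVf.
apply: ge_ereal_sup => _ [x /= x1 <-].
rewrite lee_fin -lecR norm_RRe (le_trans (fe x))//.
by rewrite ler_piMr // ler0c.
Qed.

(** The passage from extended-real operator norms to pointwise bounds: an
    operator norm below some [e] is in particular finite, so that convergence in
    [\bar R] becomes the usual epsilon statement. *)
Lemma cvg_opnorm0P (R : realType) (X : normedModType R[i])
    (f : nat -> X -> X) : (forall n, scalable (f n)) ->
  (opnorm (f n) @[n --> \oo] --> 0%E)%classic <->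
  (forall e : R[i], 0 < e ->
     (\forall n \near \oo, forall x, `|f n x| <= e * `|x|)%classic).
Proof.
move=> fZ; split=> [f0 e e0|fe].
  have e_real := RRe_real (gtr0_real e0); rewrite -e_real (ltcR 0) in e0.
  have : (\forall n \near \oo, (opnorm (f n) < (complex.Re e)%:E)%E)%classic.
    apply: (f0 [set z | (z < _)%E]%classic).
    by apply: open_ereal_lt'; rewrite lte_fin.
  apply: filterS => n /ltW; rewrite -e_real.
  by move/(opnorm_leP (fZ n) (ltW e0)).
have f_ge0 n : (0 <= opnorm (f n))%E.
  apply: ereal_sup_ubound; exists 0 => /=; first by rewrite normr0.
  by rewrite scalable0 // normr0.
apply/fine_cvgP.
have fin e : 0 < e ->
    (\forall n \near \oo, opnorm (f n) \is a fin_num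
       /\ fine (opnorm (f n)) <= e)%classic.
  move=> e0; apply: filterS (fe e%:C _) => [n|]; last by rewrite (ltcR 0).
  move=> /(opnorm_leP (fZ n) (ltW e0)) h.
  have ffin : opnorm (f n) \is a fin_num.
    by rewrite ge0_fin_numE // (le_lt_trans h) ?ltry.
  by split=> //; rewrite -lee_fin fineK.
split; first by apply: filterS (fin 1 ltr01) => n [].
apply/cvgrPdist_le => e /fin; apply: filterS => n [_ h].
by rewrite sub0r normrN ger0_norm //= fine_ge0.
Qed.

Lemma iter_sub_scalable (R : realType) (X : normedModType R[i])
    (T : {linear X -> X}) (n : nat) : scalable (fun x => iter n T x - x).
Proof.
move=> a x; rewrite scalerBr; congr (_ - _).
by elim: n => [//|n IH]; rewrite /= IH linearZ.
Qed.

Lemma bounded_operatorP (R : realType) (X : normedModType R[i])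
    (T : {linear X -> X}) :
  bounded_operator T <->
  exists2 M : R[i], 0 < M & forall x, `|T x| <= M * `|x|.
Proof.
split=> [[M TM]|[M M0 TM]].
  exists (`|M| + 1)%:C => [|x]; first by rewrite (ltcR 0) ltr_wpDl.
  rewrite (le_trans (TM x))// ler_wpM2r // lecR (le_trans (ler_norm M)) //.
  by rewrite lerDl.
by exists (complex.Re M) => x; rewrite RRe_real // gtr0_real.
Qed.

Lemma bounded_operator_iter (R : realType) (X : normedModType R[i])
    (T : {linear X -> X}) (n : nat) : bounded_operator T ->
  exists2 M : R[i], 0 < M & forall x, `|iter n T x| <= M * `|x|.
Proof.
move=> /bounded_operatorP[M M0 TM]; exists (M ^+ n); first exact: exprn_gt0.
elim: n => [|n IH] x /=; first by rewrite expr0 mul1r.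
by rewrite exprS -mulrA (le_trans (TM _))// ler_pM2l.
Qed.

Lemma near_identity_bounded_below (R : realType) (X : normedModType R[i])
    (f : X -> X) (x : X) :
  `|f x - x| <= 2^-1 * `|x| -> `|x| <= 2 * `|f x|.
Proof.
move=> fx; rewrite -ler_pdivrMl ?ltr0n // -(lerD2r (2^-1 * `|x|)).
rewrite {1 2}[2^-1 * _]mulrC -splitr.
rewrite -{1}[x](subKr (f x)) (le_trans (ler_normB _ _)) //.
by rewrite lerD2l.
Qed.

(** One power [T^N] within 1/2 of the identity suffices: [T^N] is bounded below,
    and [T^N x = T^(N-1) (T x)] is controlled by [T x]. *)
Lemma rigid_bounded_below (R : realType) (X : normedModType R[i])
    (T : {linear X -> X}) : uniformly_rigid T ->
  exists2 c : R[i], 0 < c & forall x, `|x| <= c * `|T x|.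
Proof.
move=> [bT [k [_ k0 kT]]].
move/cvg_opnorm0P: kT => /(_ (fun n => iter_sub_scalable T (k n)) 2^-1).
rewrite invr_gt0 ltr0n => /(_ isT)[n _ /(_ n (leqnn n)) kn].
have [M M0 TM] := bounded_operator_iter (k n).-1 bT.
exists (2 * M); first exact: mulr_gt0.
move=> x; apply: (le_trans (near_identity_bounded_below (kn x))).
by rewrite -(prednK (k0 n)) iterSr -mulrA ler_pM2l.
Qed.

Lemma bounded_operator_continuous (R : realType) (X : normedModType R[i])
    (T : {linear X -> X}) : bounded_operator T -> continuous T.
Proof.
move=> /bounded_operatorP[M M0 TM].
apply: bounded_linear_continuous; apply/linear_boundedP.
exists M; split; first exact: gtr0_real.
by move=> r /ltW Mr x; rewrite (le_trans (TM x)) // ler_wpM2r.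
Qed.

(** A lower bound turns Cauchy sequences of images into Cauchy sequences of
    preimages; completeness of [X] does the rest. *)
Lemma cvgn_bounded_below (R : realType) (X : completeNormedModType R[i])
    (T : {linear X -> X}) (c : R[i]) (u : nat -> X) :
  0 < c -> (forall x, `|x| <= c * `|T x|) ->
  cvgn (T \o u) -> cvgn u.
Proof.
move=> c0 cT /cvg_cauchy/cauchy_ballP Tu.
apply/cauchy_cvgP/cauchy_ballP => e e0.
have := Tu (e / c) (divr_gt0 e0 c0).
near_simpl => Tue; near_simpl.
apply: filterS Tue => -[m n] /=; rewrite -!ball_normE /= -linearB => h.
by rewrite (le_lt_trans (cT _)) // -ltr_pdivlMl // mulrC.
Qed.

(** The preimage of [y] is the limit of [T^(k_n - 1) y], whose images under [T]
    converge to [y] by rigidity. *)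
Lemma rigid_surjective (R : realType) (X : completeNormedModType R[i])
    (T : {linear X -> X}) (y : X) : uniformly_rigid T -> exists x, T x = y.
Proof.
move=> rT; have [c c0 cT] := rigid_bounded_below rT.
have [bT [k [_ k0]]] := rT.
move/cvg_opnorm0P => /(_ (fun n => iter_sub_scalable T (k n))) kT.
pose u n := iter (k n).-1 T y.
have Tu n : T (u n) = iter (k n) T y by rewrite -iterS prednK.
have Tuy : ((T \o u) n @[n --> \oo] --> y)%classic.
  apply/cvgrPdist_le => e e0.
  (* Rigidity is used at e / (1 + |y|), as |y| itself may vanish. *)
  have y1 : 0 < 1 + `|y| by rewrite ltr_pwDl.
  apply: filterS (kT _ (divr_gt0 e0 y1)) => n /(_ y).
  rewrite /= Tu distrC => /le_trans; apply.
  by rewrite mulrAC ler_pdivrMr // ler_pM2l // lerDr.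
have /cvg_ex[x ux] : cvgn u.
  by apply: (cvgn_bounded_below c0 cT); apply/cvg_ex; exists y.
exists x; apply: (cvg_unique _ _ Tuy) => //.
by apply: continuous_cvg ux; exact: bounded_operator_continuous.
Qed.

(** Writing [x = T^k z] with [z = S^k x] turns [S^k x - x] into [z - T^k z],
    which is small relative to [|z|], and [|z| <= 2 |x|] once [T^k] is within 1/2
    of the identity; hence the use of [e / 2] to reach [e]. *)
Lemma rigid_inverse (R : realType) (X : normedModType R[i])
    (T S : {linear X -> X}) : bounded_operator S -> cancel S T ->
  uniformly_rigid T -> uniformly_rigid S.
Proof.
move=> bS SK [_ [k [ik k0 kT]]]; split=> //; exists k; split=> //.
apply/cvg_opnorm0P => [n|e e0]; first exact: iter_sub_scalable.
move/cvg_opnorm0P: kT => /(_ (fun n => iter_sub_scalable T (k n))) kT.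
apply: filterS2 (kT _ (divr_gt0 e0 (ltr0n _ 2))) (kT 2^-1 _) => [n h1 h2 x|].
  (* Substituting T^k z for x, with z generalized, leaves an estimate on T. *)
  have : iter (k n) T (iter (k n) S x) = x.
    by elim: (k n) {h1 h2} => // m IH; rewrite iterSr iterS SK.
  move: (iter (k n) S x) => z <-.
  rewrite distrC (le_trans (h1 _)) // -mulrA ler_pM2l //.
  by rewrite ler_pdivrMl ?ltr0n // near_identity_bounded_below.
by rewrite invr_gt0.
Qed.

Theorem proposition2p1 (R : realType) (X : completeNormedModType R[i])
    (T : {linear X -> X}) (rigidT : uniformly_rigid T) :
  exists S : {linear X -> X},
    [/\ bounded_operator S, cancel T S, cancel S T & uniformly_rigid S].
Proof.
have [c c0 cT] := rigid_bounded_below rigidT.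
have /choice[s sK] := fun y => rigid_surjective y rigidT.
have injT : injective T.
  move=> x y Txy; apply/eqP; rewrite -subr_eq0 -normr_le0.
  by rewrite (le_trans (cT _)) // linearB /= Txy subrr normr0 mulr0.
have lin_s : linear s by move=> a x y; apply: injT; rewrite linearP !sK.
pose S : {linear X -> X} := HB.pack s (GRing.isLinear.Build _ _ _ _ s lin_s).
have bS : bounded_operator S.
  by apply/bounded_operatorP; exists c => // y; rewrite (le_trans (cT _)) //= sK.
exists S; split=> //; first exact: inj_can_sym.
exact: rigid_inverse rigidT.
Qed.
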